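(* Let $\mathcal{S}=\mathbb{R}^d$ with the componentwise natural order $\ge$. Assume that the ($\tau$-)partial quantile points $x_\tau$, $\tau\in(0,1)$, are partial-monotone, i.e. $x_\tau\ge x_{\tau'}$ (componentwise) whenever $\tau\ge\tau'$. Let $\{\hat x_\tau:\tau\in(0,1)\}$ be an initial ($\mathbb{R}^d$-valued) estimator of the partial quantile points and let $\hat x_\tau^r$ be its componentwise rearrangement $$\hat x^r_{\tau,j}=\inf\left\{y\in\mathbb{R}:\int_0^11\{\hat x_{u,j}\le y\}\,du\ge\tau\right\},\qquad j=1,\dots,d.$$ Then, for any $\kappa\ge1$, $$\int_0^1\sum_{j=1}^d|\hat x^r_{\tau,j}-x_{\tau,j}|^\kappa\,d\tau\le\int_0^1\sum_{j=1}^d|\hat x_{\tau,j}-x_{\tau,j}|^\kappa\,d\tau$$ with probability one.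
   Context: $X$ is an $\mathbb{R}^d$-valued random variable on a probability space with probability $P$; the partial order is $a\succcurlyeq b$ iff $a_j\ge b_j$ for all $j$. $\mathcal{C}(x)$ is the set of points comparable with $x$, $p_x=P(X\in\mathcal{C}(x))$, $\mathcal{Q}(\tau)=\{x: P(X\succcurlyeq x\mid X\in\mathcal{C}(x))\ge1-\tau,\ P(X\preccurlyeq x\mid X\in\mathcal{C}(x))\ge\tau\}$, and a $\tau$-partial quantile point $x_\tau$ is any maximizer of $p_x$ over $x\in\mathcal{Q}(\tau)$. $x_{\tau,j}$, $\hat x_{\tau,j}$ denote $j$-th components. Partial-monotonicity in particular implies $x_\tau$ is unique for every $\tau\in(0,1)$. *)

(* Defs.v *)
From HB Require Import structures.
From mathcomp Require Import all_boot all_order all_algebra.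
From mathcomp Require Import all_classical all_reals all_analysis.

Set Implicit Arguments.
Unset Strict Implicit.
Unset Printing Implicit Defensive.

Import Order.TTheory GRing.Theory Num.Theory.
Import numFieldNormedType.Exports.

Local Open Scope classical_set_scope.
Local Open Scope ring_scope.

(* R^d is [d.-tuple R], with the sigma-algebra generated by the coordinates,
   that is, the Borel one. *)

Definition succeq (R : realType) (d : nat) (a b : d.-tuple R) : Prop :=
  forall j : 'I_d, tnth b j <= tnth a j.

Definition comparable_set (R : realType) (d : nat) (x : d.-tuple R) :
  set (d.-tuple R) := [set y | succeq y x \/ succeq x y].

(* When [P B = 0] this is 0, since division by 0 yields 0. *)
Definition cond_prob (R : realType) (disp : measure_display)
  (Omega : measurableType disp) (P : probability Omega R)
  (A B : set Omega) : R := fine (P (A `&` B)) / fine (P B).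

Section PartialQuantile.
Context {R : realType} {disp : measure_display} {Omega : measurableType disp}.
Context {P : probability Omega R} {d : nat}.
Context (X : {RV P >-> d.-tuple R}).

Definition comparable_prob (x : d.-tuple R) : R :=
  fine (P (X @^-1` comparable_set x)).

(* For 0 < tau < 1, points x with [comparable_prob x = 0], at which the
   conditional probabilities are undefined, do not belong to this set. *)
Definition partial_quantile_set (tau : R) : set (d.-tuple R) :=
  [set x | 1 - tau <= cond_prob P (X @^-1` [set y | succeq y x])
                                  (X @^-1` comparable_set x)
        /\ tau <= cond_prob P (X @^-1` [set y | succeq x y])
                              (X @^-1` comparable_set x)].

Definition is_partial_quantile (tau : R) (x : d.-tuple R) : Prop :=
  partial_quantile_set tau x /\
  forall y, partial_quantile_set tau y ->
    comparable_prob y <= comparable_prob x.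

(* All partial quantile points are compared, not just one chosen for each tau;
   the case tau = tau' is then uniqueness of the point. *)
Definition partial_monotone : Prop :=
  forall tau tau' : R, 0 < tau < 1 -> 0 < tau' < 1 -> tau' <= tau ->
  forall x x' : d.-tuple R,
    is_partial_quantile tau x -> is_partial_quantile tau' x' -> succeq x x'.

End PartialQuantile.

(* For 0 < tau < 1 and f measurable on ]0, 1[, the set is nonempty and bounded
   below, so the real-valued [inf] is the genuine infimum. *)
Definition rearrangement (R : realType) (f : R -> R) (tau : R) : R :=
  inf [set y | (tau%:E <=
    \int[@lebesgue_measure R]_(u in `]0%R, 1%R[) (((f u <= y)%R)%:R)%:E)%E].

Definition tuple_rearrangement (R : realType) (d : nat)
  (f : R -> d.-tuple R) (tau : R) : d.-tuple R :=
  [tuple rearrangement (fun u => tnth (f u) j) tau | j < d].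

(* Families indexed by ]0, 1[ are functions on R whose values outside ]0, 1[
   are never used. *)
Definition quantile_distance (R : realType) (d : nat) (kappa : R)
  (f g : R -> d.-tuple R) : \bar R :=
  (\int[@lebesgue_measure R]_(t in `]0%R, 1%R[)
     (\sum_(j < d) `| tnth (f t) j - tnth (g t) j | `^ kappa)%R%:E)%E.

(* Main.v *)
(* Fix one coordinate, with f the estimator, f* its rearrangement and g the
   target, which is nondecreasing.  Writing |a - b|^k as the integral over s
   between a and b of the derivative k |s - b|^(k-1) and applying Tonelli, the
   distance of f to g becomes an integral over the levels s of
     int_{f <= s} h_s^+ + int_{f > s} h_s^-,
   where h_s^+ and h_s^- are the parts s < g and g <= s of k |s - g|^(k-1).
   As g is nondecreasing and k >= 1, h_s^+ is nondecreasing and h_s^- is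
   nonincreasing.  The sets {f* <= s} and {f <= s} have the same measure and the
   former is an initial segment of ]0, 1[, so each term can only decrease when f
   is replaced by f*, level by level. *)

Require Import Defs.
From HB Require Import structures.
From mathcomp Require Import all_boot all_order all_algebra.
From mathcomp Require Import all_classical all_reals all_analysis.
From mathcomp Require Import measurable_realfun.

Set Implicit Arguments.
Unset Strict Implicit.
Unset Printing Implicit Defensive.

Import Order.TTheory GRing.Theory Num.Theory.
Import numFieldNormedType.Exports.

Local Open Scope classical_set_scope.
Local Open Scope ring_scope.

(** * Exchange inequality for two sets of equal measure *)

(** The common part of [A] and [B] cancels, and the two differences have equal finite measure. The
    supremum of [phi] over A \ B is a constant separating its values there from those on B \ A. *)
Lemma le_integral_exchange (d : measure_display) (T : measurableType d)
    (R : realType) (mu : {measure set T -> \bar R}) (A B : set T)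
    (phi : T -> R) :
  measurable A -> measurable B -> measurable_fun (A `|` B) phi ->
  (forall t, 0 <= phi t) -> mu A = mu B -> (mu A < +oo)%E ->
  (forall t u, (A `\` B) t -> (B `\` A) u -> phi t <= phi u) ->
  (\int[mu]_(t in A) (phi t)%:E <= \int[mu]_(t in B) (phi t)%:E)%E.
Proof.
move=> mA mB mphi phi0 muAB muAfin phi_le.
have mDAB : measurable (A `\` B) by exact: measurableD.
have mDBA : measurable (B `\` A) by exact: measurableD.
have mI : measurable (A `&` B) by exact: measurableI.
have mphiS C : measurable C -> C `<=` A `|` B ->
    measurable_fun C phi.
  move=> mC CAB; apply: measurable_funS mphi => //.
  exact: measurableU.
have splitI C C' : measurable C -> measurable C' -> C `<=` A `|` B ->
    (\int[mu]_(t in C) (phi t)%:E =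
     \int[mu]_(t in C `\` C') (phi t)%:E +
     \int[mu]_(t in C `&` C') (phi t)%:E)%E.
  move=> mC mC' CAB; rewrite -{1}(setDUK (@subIsetl _ C C')) setUC.
  have -> : C `\` (C `&` C') = C `\` C' by rewrite setDIr setDv set0U.
  rewrite ge0_integral_setU//.
  - exact: measurableD.
  - exact: measurableI.
  - apply/measurable_EFinP; apply: mphiS.
      by apply: measurableU; [exact: measurableD|exact: measurableI].
    by move=> t [[Ct _]|[Ct _]]; exact: CAB.
  - by move=> t _; rewrite lee_fin.
  - by rewrite disj_set2E; apply/eqP/seteqP; split=> // t [[_ ?] [_ ?]].
rewrite (splitI A B)// (splitI B A)//.
rewrite [in leRHS](setIC B A); apply: leeD2r.
have muD : mu (A `\` B) = mu (B `\` A).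
  have muBfin : (mu B < +oo)%E by rewrite -muAB.
  by rewrite (measureD mA mB muAfin) (measureD mB mA muBfin) setIC; congr (_ - _)%E.
(* The added 0 keeps [c] nonnegative when A \ B is empty. If [phi] is unbounded on A \ B, then [c]
   is infinite, but B \ A is then empty and both differences are null. *)
pose c := ereal_sup (0%:E |` [set (phi t)%:E | t in A `\` B]).
apply: (@le_trans _ _ (c * mu (A `\` B))%E).
  rewrite -integral_cst//; apply: ge0_le_integral => //.
  - by move=> t _; rewrite lee_fin.
  - by apply/measurable_EFinP; apply: mphiS => // t [At _]; left.
  - by move=> t Dt; apply: ereal_sup_ubound; right; exists t.
rewrite muD -integral_cst//; apply: ge0_le_integral => //.
- by move=> t _; apply: ereal_sup_ubound; left.
- by apply/measurable_EFinP; apply: mphiS => // t [Bt _]; right.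
- move=> u Du; apply: ge_ereal_sup => _ [->|[t Dt <-]]; rewrite lee_fin//.
  exact: phi_le.
Qed.


(** * Powers of a distance as integrals over levels *)

(** Away from 0 differentiability gives continuity; 0 is treated by hand. For p = 0 the power is the
    constant 1, at 0 too; this case occurs in [slope] with exponent 1. *)
Lemma norm_powR_continuous (R : realType) (p : R) : 0 <= p ->
  continuous (fun x : R => `|x| `^ p).
Proof.
rewrite le_eqVlt => /predU1P[<-|p0] x.
  by under eq_fun do rewrite powRr0; exact: cvg_cst.
have [->|x0] := eqVneq x 0.
  rewrite /continuous_at normr0 powR0 ?gt_eqF//; apply/cvgr0Pnorm_lt => e e0.
  (* The radius is e^(1/p), whose p-th power is e. *)
  have : \forall y \near (0 : R), `|y| < e `^ p^-1.
    have /cvgr0Pnorm_lt : (@id R) y @[y --> (0:R)] --> (0:R) by exact: cvg_id.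
    by apply; exact: powR_gt0.
  apply: filterS => y ye; rewrite ger0_norm ?powR_ge0//.
  have -> : e = (e `^ p^-1) `^ p by rewrite -powRrM mulVf ?gt_eqF// powRr1// ltW.
  by rewrite gt0_ltr_powR// nnegrE ?powR_ge0.
suff : {for x, continuous ((@powR R ^~ p) \o (@Num.norm R R))} by [].
apply: continuous_comp.
  exact: norm_continuous.
apply: differentiable_continuous; apply/derivable1_diffP.
by apply: derivable_powR; rewrite in_itv/= andbT normr_gt0.
Qed.

Lemma is_derive_norm_powR (R : realType) (p x : R) : x != 0 ->
  is_derive x 1 (fun y : R => `|y| `^ p) (Num.sg x * (p * `|x| `^ (p - 1))).
Proof.
move=> x0; have [xn|xp] : x < 0 \/ 0 < x by apply/orP; rewrite -neq_lt.
  apply: (@near_eq_is_derive _ _ _ (fun y => (- y) `^ p)).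
    by near=> y; rewrite ltr0_norm//; near: y; exact: lt_nbhsl.
  rewrite ltr0_sg// ltr0_norm// mulrC.
  have dN : is_derive x 1 (-%R : R -> R) (- 1) by exact: is_deriveN.
  have dP : is_derive (- x) 1 (@powR R ^~ p) (p * (- x) `^ (p - 1)).
    by apply: is_derive1_powR; rewrite oppr_gt0.
  exact: (is_derive1_comp dP dN).
apply: (@near_eq_is_derive _ _ _ (fun y => y `^ p)).
  by near=> y; rewrite gtr0_norm//; near: y; exact: lt_nbhsr.
rewrite gtr0_sg// gtr0_norm// mul1r; exact: is_derive1_powR.
Unshelve. all: end_near. Qed.

(* [slope p b] is, up to sign, the derivative of [s |-> `|s - b| `^ p]. *)
Definition slope (R : realType) (p b s : R) : R := p * `|s - b| `^ (p - 1).

Lemma slope_ge0 (R : realType) (p b s : R) : 0 <= p -> 0 <= slope p b s.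
Proof. by move=> p0; rewrite mulr_ge0// powR_ge0. Qed.


Lemma slope_continuous (R : realType) (p b : R) : 1 <= p ->
  continuous (slope p b).
Proof.
move=> p1 s; apply: (@cvgM R); first exact: cvg_cst.
suff : {for s, continuous ((fun y : R => `|y| `^ (p - 1)) \o (fun s => s - b))}.
  by [].
apply: continuous_comp; first by apply: (@cvgB R R); [exact: cvg_id|exact: cvg_cst].
by apply: norm_powR_continuous; rewrite subr_ge0.
Qed.

(** A constant sign [sigma] makes sigma |s - b|^p a primitive. The sign is prescribed on the open
    interval only, so [b] may be an endpoint, where continuity of the primitive suffices. *)
Lemma integral_slope (R : realType) (p b x y sigma : R) : 1 <= p -> x < y ->
  sigma != 0 ->
  {in `]x, y[, forall s, Num.sg (s - b) = sigma} ->
  (\int[lebesgue_measure]_(s in `[x, y]) (slope p b s)%:E =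
    (sigma * (`|y - b| `^ p - `|x - b| `^ p))%:E)%E.
Proof.
move=> p1 xy sigma0 hsigma.
pose F s : R := sigma * `|s - b| `^ p.
have FS : F = sigma *: ((fun y : R => `|y| `^ p) \o (fun s => s - b)) by [].
have cF : continuous F.
  move=> s; apply: (@cvgM R); first exact: cvg_cst.
  suff : {for s, continuous ((fun y : R => `|y| `^ p) \o (fun s => s - b))}.
    by [].
  apply: continuous_comp; first by apply: (@cvgB R R); [exact: cvg_id|exact: cvg_cst].
  by apply: norm_powR_continuous; rewrite (le_trans ler01).
have dF s : s \in `]x, y[ -> is_derive s 1 F (slope p b s).
  move=> sxy.
  have sb0 : s - b != 0 by rewrite -sgr_eq0 hsigma.
  have db : is_derive s 1 (fun s : R => s - b) (1 - 0).
    exact: is_deriveB.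
  have dG := @is_derive1_comp R (fun y => `|y| `^ p) (fun s => s - b) s _ _
    (is_derive_norm_powR p sb0) db.
  rewrite FS; apply: is_derive_eq (is_deriveZ sigma dG) _.
  (* One factor [sigma] comes from the primitive and one from differentiating the absolute value;
     their product is 1. *)
  rewrite subr0 mulr1 -(hsigma _ sxy) scalerA -expr2 sqr_sg sb0 scale1r.
  by [].
rewrite (@continuous_FTC2 _ _ F)//.
- by rewrite -EFinB mulrBr.
- by apply: continuous_subspaceT; exact: slope_continuous.
- split.
  + by move=> s sxy; have [] := dF _ sxy.
  + by apply: cvg_at_right_filter; exact: cF.
  + by apply: cvg_at_left_filter; exact: cF.
- by move=> s sxy; rewrite derive1E; have [] := dF _ sxy.
Qed.

(* [layer p a b] is [slope p b] cut off outside the half-open interval with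
   endpoints [a] and [b]; its dependence on [a] is only through [a <= s]. *)
Definition layer (R : realType) (p a b s : R) : R :=
  if a <= s then (if s < b then slope p b s else 0)
  else (if b <= s then slope p b s else 0).

Lemma layer_ge0 (R : realType) (p a b s : R) : 0 <= p -> 0 <= layer p a b s.
Proof. by move=> p0; rewrite /layer; do 2 case: ifP => _ //; exact: slope_ge0. Qed.

Lemma integral_slope_co (R : realType) (p b x y sigma : R) : 1 <= p -> x < y ->
  sigma != 0 ->
  {in `]x, y[, forall s, Num.sg (s - b) = sigma} ->
  (\int[lebesgue_measure]_(s in `[x, y[) (slope p b s)%:E =
    (sigma * (`|y - b| `^ p - `|x - b| `^ p))%:E)%E.
Proof.
move=> p1 xy sigma0 hsigma; rewrite -integral_slope//.
apply: integral_itv_bndo_bndc; apply/measurable_EFinP.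
apply: measurable_funTS; apply: continuous_measurable_fun.
exact: slope_continuous.
Qed.

Lemma integral_layer (R : realType) (p a b : R) : 1 <= p ->
  (\int[lebesgue_measure]_s (layer p a b s)%:E = (`|a - b| `^ p)%:E)%E.
Proof.
move=> p1; have p0 : p != 0 by rewrite gt_eqF// (lt_le_trans ltr01).
have [ab|ba|<-] := ltgtP a b.
- transitivity (\int[lebesgue_measure]_(s in `[a, b[) (slope p b s)%:E)%E.
    rewrite [RHS]integral_mkcond; apply: eq_integral => s _.
    rewrite patchE mem_setE in_itv/= /layer.
    case: (leP a s) => //= sa; rewrite ?leNgt ?(lt_trans sa)//.
    by case: ifP.
  (* To the left of [b] the distance to [b] decreases in [s], hence the sign -1. *)
  rewrite (@integral_slope_co _ _ _ _ _ (-1))//.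
  + by rewrite subrr normr0 powR0// sub0r mulN1r opprK.
  + by move=> s; rewrite in_itv/= => /andP[_ sb]; rewrite ltr0_sg// subr_lt0.
- transitivity (\int[lebesgue_measure]_(s in `[b, a[) (slope p b s)%:E)%E.
    rewrite [RHS]integral_mkcond; apply: eq_integral => s _.
    rewrite patchE mem_setE in_itv/= /layer.
    case: (leP a s) => //= sa; last by rewrite andbT; case: ifP.
    by rewrite andbF ltNge (le_trans _ sa)// ltW.
  rewrite (@integral_slope_co _ _ _ _ _ 1)//.
  + by rewrite subrr normr0 powR0// subr0 mul1r.
  + by move=> s; rewrite in_itv/= => /andP[sb _]; rewrite gtr0_sg// subr_gt0.
- rewrite subrr normr0 powR0// integral0_eq// => s _; rewrite /layer.
  by case: leP.
Qed.

Lemma measurable_layer (R : realType) (p : R) (f g : R -> R) :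
  measurable_fun [set: R] f -> measurable_fun [set: R] g ->
  measurable_fun [set: R * R] (fun z => layer p (f z.1) (g z.1) z.2).
Proof.
move=> mf mg.
have mf1 : measurable_fun [set: R * R] (fun z => f z.1).
  exact: measurableT_comp.
have mg1 : measurable_fun [set: R * R] (fun z => g z.1).
  exact: measurableT_comp.
have ms : measurable_fun [set: R * R] (fun z => slope p (g z.1) z.2).
  apply: measurable_funM => //.
  apply: (measurableT_comp (measurable_powR (p - 1))).
  by apply: measurableT_comp => //; exact: measurable_funB.
apply: measurable_fun_ifT; first exact: measurable_fun_ler.
  by apply: measurable_fun_ifT => //; exact: measurable_fun_ltr.
by apply: measurable_fun_ifT => //; exact: measurable_fun_ler.
Qed.

Lemma integral_dist_powR (R : realType) (p : R) (D : set R) (f g : R -> R) :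
  1 <= p -> measurable D -> measurable_fun D f -> measurable_fun D g ->
  (\int[lebesgue_measure]_(t in D) (`|f t - g t| `^ p)%:E =
   \int[lebesgue_measure]_s
     (\int[lebesgue_measure]_(t in D) (layer p (f t) (g t) s)%:E))%E.
Proof.
move=> p1 mD mf mg; have p0 : 0 <= p by rewrite (le_trans ler01).
have mf' := (measurable_restrictT f mD).1 mf.
have mg' := (measurable_restrictT g mD).1 mg.
(* Tonelli is applied on the whole plane: extension by 0 makes [f] and [g] measurable on the line,
   and the indicator restricts [t] to [D]. *)
pose k (z : R * R) : \bar R :=
  ((layer p ((f \_ D) z.1) ((g \_ D) z.1) z.2) * \1_D z.1)%:E.
have kE t s : k (t, s) = (fun t => (layer p (f t) (g t) s)%:E) \_ D t.
  rewrite /k/= indicE [RHS]patchE; case: ifPn => tD; last by rewrite mulr0.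
  by rewrite !patchE tD mulr1.
transitivity (\int[lebesgue_measure]_t \int[lebesgue_measure]_s k (t, s))%E.
  rewrite integral_mkcond; apply: eq_integral => t _.
  rewrite patchE; case: ifPn => tD.
    rewrite -integral_layer//; apply: eq_integral => s _.
    by rewrite kE patchE tD.
  by rewrite integral0_eq// => s _; rewrite kE patchE (negbTE tD).
rewrite (@fubini_tonelli _ _ _ _ _ lebesgue_measure lebesgue_measure)/=.
- apply: eq_integral => s _; rewrite [RHS]integral_mkcond.
  by apply: eq_integral => t _; exact: kE.
- apply/measurable_EFinP; apply: measurable_funM.
    exact: measurable_layer.
  by apply: measurableT_comp => //; exact: measurable_indic.
- by move=> z; rewrite lee_fin mulr_ge0// ?layer_ge0// indicE.
Qed.

(** The closed upper rays generate the Borel sets, and their preimages under a nondecreasing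
    function on an interval are intervals. *)
Lemma nondecreasing_in_measurable (R : realType) (D : set R) (g : R -> R) :
  is_interval D -> {in D &, {homo g : t u / t <= u}} -> measurable_fun D g.
Proof.
move=> itvD g_nd; apply: (measurability (@RGenCInfty.G R)).
  exact: RGenCInfty.measurableE.
move=> _ [_ [r ->] <-]; apply: is_interval_measurable => t u.
rewrite /= !in_itv/= !andbT => -[Dt gt] [Du _] v tvu.
have Dv : D v by exact: itvD tvu.
have /andP[tv _] := tvu.
by split=> //; rewrite in_itv/= andbT (le_trans gt)// g_nd// inE.
Qed.

(** * Rearrangement on the unit interval *)

Section UnitInterval.
Context {R : realType}.
Local Notation mu := (@lebesgue_measure R).
Let D : set R := `]0%R, 1%R[.

Let mD : measurable D. Proof. exact: measurable_itv. Qed.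

Let itvD : is_interval D. Proof. exact: interval_is_interval. Qed.

Let muD : mu D = 1%E.
Proof. by rewrite lebesgue_measure_itv/= lte01 oppr0 adde0. Qed.

Let mu_sub_fin (A : set R) : measurable A -> A `<=` D -> (mu A < +oo)%E.
Proof.
move=> mA AD; apply: (@le_lt_trans _ _ (mu D)); last by rewrite muD ltry.
by apply: le_measure; rewrite ?inE.
Qed.

(** Its measure, as a function of [y], is the distribution function of [f] under the uniform law on
    ]0, 1[. *)
Definition sublevel (f : R -> R) (y : R) : set R := D `&` [set u | f u <= y].

Lemma sublevel_le (f : R -> R) : {homo sublevel f : y z / y <= z >-> y `<=` z}.
Proof. by move=> y z yz u [Du /= fuy]; split=> //=; exact: le_trans yz. Qed.

Lemma measurable_sublevel (f : R -> R) (y : R) :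
  measurable_fun D f -> measurable (sublevel f y).
Proof.
move=> mf; have := mf mD _ (measurable_itv `]-oo, y]).
by congr measurable; apply/seteqP; split=> u [Du]; rewrite /= in_itv/=.
Qed.

Lemma integral_sublevel (f : R -> R) (y : R) : measurable_fun D f ->
  (\int[mu]_(u in D) (((f u <= y)%R)%:R)%:E = mu (sublevel f y))%E.
Proof.
move=> mf; rewrite -[in RHS](@setIidl _ (sublevel f y) D); last by move=> u [].
rewrite -integral_indic//; last exact: measurable_sublevel.
apply: eq_integral => u; rewrite inE => Du; rewrite indicE.
have -> : (u \in sublevel f y) = (f u <= y) => //.
by apply/idP/idP; [rewrite inE => -[]|move=> fu; rewrite inE; split].
Qed.

(** This is the Galois connection between a quantile function and its distribution function. The set
    [S] of admissible levels is upward closed, nonempty and bounded below, and it contains its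
    infimum because the distribution function is right-continuous. *)
Lemma rearrangement_leP (f : R -> R) (t s : R) : measurable_fun D f ->
  0 < t < 1 -> (rearrangement f t <= s) = (t%:E <= mu (sublevel f s))%E.
Proof.
move=> mf /andP[t0 t1].
pose S := [set y | (t%:E <= mu (sublevel f y))%E].
have -> : rearrangement f t = inf S.
  by rewrite /rearrangement; congr inf; apply/funext => y; rewrite /S /= -integral_sublevel.
have msub y : measurable (sublevel f y) by exact: measurable_sublevel.
have Sup y z : y <= z -> S y -> S z.
  move=> yz /le_trans; apply; apply: le_measure; rewrite ?inE;
    [exact: msub|exact: msub|exact: sublevel_le].
have S0 : S !=set0.
  (* The sublevels exhaust [D], so their measures eventually exceed t < 1. *)
  have cvg1 : mu (sublevel f n%:R) @[n --> \oo] --> 1%E.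
    rewrite -muD; have <- : \bigcup_n sublevel f n%:R = D.
      apply/seteqP; split=> [u [n _ []]//|u Du].
      by exists (Num.truncn (f u)).+1 => //; split=> //=; rewrite ltW// truncnS_gt.
    apply: nondecreasing_cvg_mu.
    - by move=> n; exact: msub.
    - by apply: bigcup_measurable => n _; exact: msub.
    by move=> m n mn; apply/subsetPset/sublevel_le; rewrite ler_nat.
  have /cvg1[n _ /(_ n (leqnn n)) Sn] : nbhs (1%E : \bar R) [set z | t%:E < z]%E.
    by apply: open_nbhs_nbhs; split; [exact: open_ereal_gt_ereal|rewrite /= lte_fin].
  by exists n%:R; exact: ltW.
have Slb : has_lbound S.
  (* The sublevels shrink to the empty set, so their measures eventually drop below t > 0. *)
  have cvg0 : mu (sublevel f (- n%:R)) @[n --> \oo] --> 0%E.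
    rewrite -(measure0 mu); have <- : \bigcap_n sublevel f (- n%:R) = set0.
      rewrite -subset0 => u /(_ (Num.truncn (- f u)).+1 I)[_ /=].
      by rewrite leNgt ltrNl truncnS_gt.
    apply: nonincreasing_cvg_mu.
    - by apply: mu_sub_fin => // u [].
    - by move=> n; exact: msub.
    - by apply: bigcap_measurable => // n _; exact: msub.
    - by move=> m n mn; apply/subsetPset/sublevel_le; rewrite lerN2 ler_nat.
  have /cvg0[n _ /(_ n (leqnn n)) Sn] : nbhs (0%E : \bar R) [set z | z < t%:E]%E.
    by apply: open_nbhs_nbhs; split; [exact: open_ereal_lt_ereal|rewrite /= lte_fin].
  exists (- n%:R) => y Sy; rewrite leNgt; apply/negP => /ltW yn.
  by have := Sup _ _ yn Sy; rewrite /S/= leNgt Sn.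
apply/idP/idP => [infs|ts]; last exact: ge_inf.
have Sn n : S (s + n.+1%:R^-1).
  have [y Sy /ltW ys] : exists2 y, S y & y < s + n.+1%:R^-1.
    by apply: inf_lt => //; rewrite (le_lt_trans infs)// ltrDl.
  exact: Sup Sy.
(* Right-continuity at [s], by continuity from above of the finite measure on [D]. *)
have cvgs : mu (sublevel f (s + n.+1%:R^-1)) @[n --> \oo] --> mu (sublevel f s).
  have <- : \bigcap_n sublevel f (s + n.+1%:R^-1) = sublevel f s.
    apply/seteqP; split=> [u us|u us n _]; last first.
      by apply: sublevel_le us; rewrite lerDl.
    split; first by have [] := us 0%N I.
    rewrite /=; apply/ler_addgt0Pr => e e0.
    have [_ /= /le_trans] := us (Num.truncn e^-1) I; apply.
    rewrite lerD2l invf_ple ?posrE//; exact: ltW (truncnS_gt _).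
  apply: nonincreasing_cvg_mu.
  - by apply: mu_sub_fin => // u [].
  - by move=> n; exact: msub.
  - by apply: bigcap_measurable => // n _; exact: msub.
  - move=> m n mn; apply/subsetPset/sublevel_le.
    by rewrite lerD2l lef_pV2 ?posrE// ler_nat.
apply: (cvge_to_ge cvgs).
by near=> n; exact: Sn.
Unshelve. all: end_near. Qed.

Let measurable_fun_ifD (b : R -> bool) (f g : R -> R) :
  measurable_fun D b -> measurable_fun D f -> measurable_fun D g ->
  measurable_fun D (fun t => if b t then f t else g t).
Proof.
move=> mb mf mg; apply: measurable_fun_if => //.
  by apply: measurable_funS mf => // t [].
by apply: measurable_funS mg => // t [].
Qed.

Let measurable_slope (p s : R) (g : R -> R) : measurable_fun D g ->
  measurable_fun D (fun t => slope p (g t) s).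
Proof.
move=> mg; apply: measurable_funM => //.
apply: (measurableT_comp (measurable_powR (p - 1))).
by apply: measurableT_comp => //; exact: measurable_funB.
Qed.

Let measurable_slope_lt (p s : R) (g : R -> R) : measurable_fun D g ->
  measurable_fun D (fun t => if s < g t then slope p (g t) s else 0).
Proof.
move=> mg; apply: measurable_fun_ifD => //; last exact: measurable_slope.
exact: measurable_fun_ltr.
Qed.

Let measurable_slope_ge (p s : R) (g : R -> R) : measurable_fun D g ->
  measurable_fun D (fun t => if g t <= s then slope p (g t) s else 0).
Proof.
move=> mg; apply: measurable_fun_ifD => //; last exact: measurable_slope.
exact: measurable_fun_ler.
Qed.

Lemma rearrangement_nondecreasing (f : R -> R) : measurable_fun D f ->
  {in D &, {homo rearrangement f : t u / t <= u}}.
Proof.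
move=> mf t u; rewrite !inE /D /= !in_itv/= => Dt Du tu.
rewrite rearrangement_leP//; apply: (@le_trans _ _ u%:E); first by rewrite lee_fin.
by rewrite -rearrangement_leP.
Qed.

Lemma measurable_rearrangement (f : R -> R) : measurable_fun D f ->
  measurable_fun D (rearrangement f).
Proof.
move=> mf; apply: (nondecreasing_in_measurable itvD).
exact: rearrangement_nondecreasing.
Qed.

(** By [rearrangement_leP], the sublevel of the rearrangement consists of the t in [D] with t <= m,
    where m is the measure of the sublevel of [f]. This initial segment has length m. *)
Lemma measure_sublevel_rearrangement (f : R -> R) (s : R) : measurable_fun D f ->
  mu (sublevel (rearrangement f) s) = mu (sublevel f s).
Proof.
move=> mf; have msub : measurable (sublevel f s) by exact: measurable_sublevel.
have := mu_sub_fin msub (@subIsetl _ _ _).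
have : (mu (sublevel f s) <= 1)%E.
  rewrite -muD; apply: le_measure; rewrite ?inE; [exact: msub|exact: mD|].
  by move=> u [].
have : (0 <= mu (sublevel f s))%E by [].
have : sublevel (rearrangement f) s = D `&` [set t | t%:E <= mu (sublevel f s)]%E.
  apply/seteqP; split=> t [Dt ts]; split=> //;
    have t01 : 0 < t < 1 by move: Dt; rewrite /D /= in_itv.
    by rewrite /= -rearrangement_leP.
  by rewrite /= rearrangement_leP.
move: (mu (sublevel f s)) => [m| |]//=.
(* For m = 1 the segment is all of [D], which omits the endpoint 1; for m < 1 it is ]0, m]. *)
rewrite !lee_fin => -> m0; rewrite le_eqVlt => /predU1P[->|m1] _.
  rewrite -[RHS]muD; congr (mu _); apply/seteqP; split=> [t []//|t Dt]; split=> //=.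
  by move: Dt; rewrite /D /= in_itv/= lee_fin => /andP[_ /ltW].
have -> : D `&` [set t | t%:E <= m%:E]%E = `]0, m]%classic.
  apply/seteqP; split=> t; rewrite /D /= !in_itv/= lee_fin.
    by move=> [/andP[-> _] ->].
  by move=> /andP[-> tm]; rewrite tm (le_lt_trans tm).
rewrite lebesgue_measure_itv/= lte_fin; case: ltP => [_|m0']; first by rewrite oppr0 adde0.
by congr EFin; apply/eqP; rewrite eq_le m0 m0'.
Qed.

(** * Comparison level by level, then over all levels *)

(** After this splitting [f] enters only through the two domains, so that [le_integral_exchange]
    applies to integrands depending on [g] alone. *)
Lemma integral_layerE (p : R) (f g : R -> R) (s : R) : 1 <= p ->
  measurable_fun D f -> measurable_fun D g ->
  (\int[mu]_(t in D) (layer p (f t) (g t) s)%:E =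
   \int[mu]_(t in sublevel f s) (if s < g t then slope p (g t) s else 0)%:E +
   \int[mu]_(t in D `\` sublevel f s) (if g t <= s then slope p (g t) s else 0)%:E)%E.
Proof.
move=> p1 mf mg.
have msub : measurable (sublevel f s) by exact: measurable_sublevel.
have subD : sublevel f s `<=` D by move=> u [].
rewrite -[in LHS](setDUK subD) ge0_integral_setU//.
- congr (_ + _)%E; apply: eq_integral => t; rewrite inE => -[Dt fts].
    by move: fts; rewrite /layer /= => ->.
  by rewrite /layer; case: (leP (f t) s) => // fs; case: fts; split.
- exact: measurableD.
- rewrite setDUK//; apply/measurable_EFinP.
  apply: measurable_fun_ifD; [exact: measurable_fun_ler| |].
    exact: measurable_slope_lt.
  exact: measurable_slope_ge.
- by move=> t _; rewrite lee_fin layer_ge0// (le_trans ler01).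
- by rewrite disj_set2E setDIK eqxx.
Qed.

Lemma integral_layer_rearrangement_le (p : R) (f g : R -> R) (s : R) : 1 <= p ->
  measurable_fun D f -> {in D &, {homo g : t u / t <= u}} ->
  (\int[mu]_(t in D) (layer p (rearrangement f t) (g t) s)%:E <=
   \int[mu]_(t in D) (layer p (f t) (g t) s)%:E)%E.
Proof.
move=> p1 mf g_nd; have mg := nondecreasing_in_measurable itvD g_nd.
have mrf := measurable_rearrangement mf.
have msub : measurable (sublevel f s) by exact: measurable_sublevel.
have mrsub : measurable (sublevel (rearrangement f) s) by exact: measurable_sublevel.
have musub := measure_sublevel_rearrangement s mf.
have p0 : 0 <= p by rewrite (le_trans ler01).
have q0 : 0 <= p - 1 by rewrite subr_ge0.
(* The sublevel of the rearrangement is an initial segment of [D]. *)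
have lt_sub t u : (sublevel (rearrangement f) s) t ->
    D u -> ~ (sublevel (rearrangement f) s) u -> t <= u.
  move=> [Dt rt] Du nu; rewrite leNgt; apply/negP => ut; apply: nu; split=> //=.
  apply: le_trans rt; apply: rearrangement_nondecreasing; rewrite ?inE//.
  exact: ltW.
have slope_le a b : `|s - a| <= `|s - b| -> slope p a s <= slope p b s.
  move=> ab; rewrite ler_wpM2l// ge0_ler_powR// nnegrE.
rewrite !integral_layerE//; apply: leeD.
(* Points of the sublevel of [f] missing from the initial segment lie to its right, where [g] is
   larger and hence farther above [s]. *)
- apply: le_integral_exchange => //.
  + apply: measurable_funS (measurable_slope_lt p s mg) => //.
    by move=> t [[]|[]].
  + by move=> t; case: ifP => // _; exact: slope_ge0.
  + by apply: mu_sub_fin => // t [].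
  + move=> t u [rt _] [[Du _] nu].
    have tu := lt_sub _ _ rt Du nu.
    have gtu : g t <= g u by apply: g_nd; rewrite ?inE//; have [] := rt.
    case: ltP => sgt; last by case: ifP => // _; exact: slope_ge0.
    rewrite (lt_le_trans sgt gtu); apply: slope_le.
    rewrite !ltr0_norm ?subr_lt0//; last exact: lt_le_trans gtu.
    by rewrite !opprB lerD2r.
(* For the complements the order is reversed: the one of the rearrangement is a final segment, where
   [g] is larger and hence closer to [s] from below. *)
- apply: le_integral_exchange => //.
  + exact: measurableD.
  + exact: measurableD.
  + apply: measurable_funS (measurable_slope_ge p s mg) => //.
    by move=> t [[]|[]].
  + by move=> t; case: ifP => // _; exact: slope_ge0.
  + have Dfin : (mu D < +oo)%E by exact: mu_sub_fin.
    rewrite !measureD//.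
    rewrite !setIidr; [|exact: subIsetl|exact: subIsetl].
    by congr (_ - _)%E; exact: musub.
  + by apply: mu_sub_fin; [exact: measurableD|move=> t []].
  + move=> t u [[Dt nt] _] [[Du _]].
    (* Since [u] is in [D] but not in the complement of the initial segment, it belongs to that
       segment. *)
    have [ru _|nu []] := pselect (sublevel (rearrangement f) s u); last by split.
    have gut : g u <= g t by apply: g_nd; rewrite ?inE//; exact: lt_sub ru Dt nt.
    case: (leP (g t)) => gts; last by case: ifP => // _; exact: slope_ge0.
    rewrite (le_trans gut gts); apply: slope_le.
    rewrite !ger0_norm ?subr_ge0//; last exact: le_trans gut gts.
    by rewrite lerD2l lerN2.
Qed.

Lemma rearrangement_dist_powR_le (p : R) (f g : R -> R) : 1 <= p ->
  measurable_fun D f -> {in D &, {homo g : t u / t <= u}} ->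
  (\int[mu]_(t in D) (`|rearrangement f t - g t| `^ p)%:E <=
   \int[mu]_(t in D) (`|f t - g t| `^ p)%:E)%E.
Proof.
move=> p1 mf g_nd; have mg := nondecreasing_in_measurable itvD g_nd.
have mrf := measurable_rearrangement mf.
have layer0 h s : (0 <= \int[mu]_(t in D) (layer p (h t) (g t) s)%:E)%E.
  by apply: integral_ge0 => t _; rewrite lee_fin layer_ge0// (le_trans ler01).
rewrite !integral_dist_powR// !ge0_integralTE//.
(* Both integrals are suprema over nonnegative simple functions lying below the integrand. Each
   simple function below the smaller inner integral is also below the larger one. *)
apply: ereal_sup_le; apply: image_subset => h hf s.
by apply: (le_trans (hf s)); exact: integral_layer_rearrangement_le.
Qed.

End UnitInterval.

(** * From one coordinate to all coordinates, along almost every path *)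

Theorem theorem7 (R : realType) (d : nat)
  (disp : measure_display) (Omega : measurableType disp)
  (P : probability Omega R) (X : {RV P >-> d.-tuple R})
  (* the partial quantile points *)
  (x : R -> d.-tuple R)
  (hx : forall tau : R, 0 < tau < 1 -> is_partial_quantile X tau (x tau))
  (hmono : partial_monotone X)
  (* the initial estimator, on the probability space of the sample *)
  (disp' : measure_display) (Omega' : measurableType disp')
  (P' : probability Omega' R) (xhat : R -> {RV P' >-> d.-tuple R})
  (hpath : {ae P', forall w : Omega', forall j : 'I_d,
     measurable_fun (`]0, 1[%classic : set R) (fun u : R => tnth (xhat u w) j)})
  (kappa : R) (hkappa : 1 <= kappa) :
  {ae P', forall w : Omega',
     (quantile_distance kappa (tuple_rearrangement (fun u => xhat u w)) x
      <= quantile_distance kappa (fun u => xhat u w) x)%E}.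
Proof.
(* Partial monotonicity takes the larger index first, hence the order [u01], [t01]. *)
have x_nd (j : 'I_d) : {in `]0, 1[%classic &, {homo (fun t => tnth (x t) j) : t u / t <= u}}.
  move=> t u; rewrite !inE /= !in_itv/= => t01 u01 tu.
  exact: (hmono _ _ u01 t01 tu _ _ (hx _ u01) (hx _ t01) j).
apply: filterS hpath => w mxhat; rewrite /quantile_distance.
have mdist (f : R -> R) j : measurable_fun (`]0, 1[%classic : set R) f ->
    measurable_fun (`]0, 1[%classic : set R)
      (fun t => (`|f t - tnth (x t) j| `^ kappa)%:E).
  move=> mf; apply/measurable_EFinP.
  apply: (measurableT_comp (measurable_powR kappa)).
  apply: measurableT_comp => //; apply: measurable_funB => //.
  apply: nondecreasing_in_measurable; [exact: interval_is_interval|exact: x_nd].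
(* With the sums moved to the extended reals, each integral splits into one integral per
   coordinate. *)
under eq_integral do rewrite -sumEFin.
under [leRHS]eq_integral do rewrite -sumEFin.
have rE t j : tnth (tuple_rearrangement (fun u => xhat u w) t) j =
  rearrangement (fun u => tnth (xhat u w) j) t by rewrite tnth_mktuple.
rewrite !ge0_integral_sum//.
- apply: lee_sum => j _; under eq_integral do rewrite rE.
  exact: rearrangement_dist_powR_le.
- by move=> j; exact: mdist.
- move=> j; have := mdist _ j (measurable_rearrangement (mxhat j)).
  by apply: eq_measurable_fun => t _; rewrite rE.
Qed.
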